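(* Let $d, D, p \geq 1$ be integers and let $\mathbf{x}, \mathbf{y} \in \mathbb{R}^d$. Let $h_1, \ldots, h_p : [d] \to [D]$ be random functions, each sampled from a 2-wise independent family, and let $s_1, \ldots, s_p : [d] \to \{-1, 1\}$ be random functions, each sampled from a 4-wise independent family, where all $2p$ functions are chosen independently. Let $\mathbf{Cx}^{(p)}, \mathbf{Cy}^{(p)} \in \mathbb{R}^D$ denote the Count Sketches of the tensor powers $\mathbf{x}^{(p)}, \mathbf{y}^{(p)} \in \mathbb{R}^{d^p}$ with respect to the composite hash functions $$H(i_1, \ldots, i_p) = \Big(\sum_{j=1}^p h_j(i_j)\Big) \bmod D, \qquad S(i_1, \ldots, i_p) = \prod_{j=1}^p s_j(i_j),$$ that is, $\big(\mathbf{Cx}^{(p)}\big)_k = \sum_{\mathbf{u} \in [d]^p :\, H(\mathbf{u}) = k} S(\mathbf{u})\, \mathbf{x}^{(p)}_{\mathbf{u}}$ for each residue $k$ modulo $D$, and similarly for $\mathbf{y}$ with the same $H$ and $S$. Then $$\mathbb{E}\left[\left\langle \mathbf{Cx}^{(p)}, \mathbf{Cy}^{(p)} \right\rangle\right] = \left\langle \mathbf{x}^{(p)}, \mathbf{y}^{(p)} \right\rangle = \langle \mathbf{x}, \mathbf{y} \rangle^p,$$ $$\mathrm{Var}\left[\left\langle \mathbf{Cx}^{(p)}, \mathbf{Cy}^{(p)} \right\rangle\right] \leq \frac{3^p - 1}{D}\, \|\mathbf{x}\|_2^{2p}\, \|\mathbf{y}\|_2^{2p}.$$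
   Context: For an integer $m \ge 1$, $[m] = \{1, \ldots, m\}$. $\langle \cdot, \cdot \rangle$ is the standard inner product and $\|\cdot\|_2$ the Euclidean norm. The $p$-th tensor power of $\mathbf{x} = (x_1, \ldots, x_d) \in \mathbb{R}^d$ is the vector $\mathbf{x}^{(p)} \in \mathbb{R}^{d^p}$ indexed by $[d]^p$ with entries $\mathbf{x}^{(p)}_{(i_1, \ldots, i_p)} = \prod_{j=1}^p x_{i_j}$. A family $\mathcal{H}$ of functions $f : U \to R$ between finite sets is $k$-wise independent if, for every set $I \subseteq U$ of at most $k$ distinct elements and $f$ chosen at random from $\mathcal{H}$, the vector of hash values $(f(i))_{i \in I}$ is uniformly distributed on $R^{I}$. A function ''sampled from a $k$-wise independent family'' is such a random $f$. The set $[D]$ is identified with the residues modulo $D$, so that $H$ takes values in the coordinate index set of $\mathbb{R}^D$. *)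

(* Defs.v *)
From HB Require Import structures.
From mathcomp Require Import all_boot all_order all_algebra.
From mathcomp Require Import all_classical all_reals all_analysis.
Set Implicit Arguments.
Unset Strict Implicit.
Unset Printing Implicit Defensive.
Import Order.TTheory GRing.Theory Num.Theory.
Local Open Scope classical_set_scope.
Local Open Scope ring_scope.

(* Real vectors indexed by a finite type [U] are the elements of
   [{ffun U -> R}]; R^d is the case [U = 'I_d] and R^(d^p), with coordinates
   indexed by [d]^p, is the case [U = {ffun 'I_p -> 'I_d}]. *)
Definition dotp (R : realType) (U : finType) (x y : {ffun U -> R}) : R :=
  \sum_(u : U) x u * y u.

Definition norm2 (R : realType) (U : finType) (x : {ffun U -> R}) : R :=
  Num.sqrt (dotp x x).

Definition tensor_power (R : realType) (d p : nat) (x : {ffun 'I_d -> R}) :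
    {ffun {ffun 'I_p -> 'I_d} -> R} :=
  [ffun u : {ffun 'I_p -> 'I_d} => \prod_(j < p) x (u j)].
Arguments tensor_power {R d} p x.

(* The set {-1, 1} of signs is represented by [bool]: [false] stands for 1
   and [true] for -1. *)
Definition sign_val (R : realType) (b : bool) : R := (-1) ^+ b.
Arguments sign_val R b : clear implicits.

Definition count_sketch (R : realType) (U : finType) (D : nat)
    (H : U -> 'I_D) (S : U -> R) (z : {ffun U -> R}) : {ffun 'I_D -> R} :=
  [ffun k : 'I_D => \sum_(u : U | H u == k) S u * z u].

(* Residues modulo D are represented by ['I_D] = {0, ..., D-1}. *)
Definition composite_hash (d D p : nat) (hD : (0 < D)%N)
    (h : 'I_p -> {ffun 'I_d -> 'I_D}) (u : {ffun 'I_p -> 'I_d}) : 'I_D :=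
  Ordinal (ltn_pmod (\sum_(j < p) h j (u j))%N hD).

Definition composite_sign (R : realType) (d p : nat)
    (s : 'I_p -> {ffun 'I_d -> bool}) (u : {ffun 'I_p -> 'I_d}) : R :=
  \prod_(j < p) sign_val R (s j (u j)).
Arguments composite_sign R {d p} s u.

Definition tensor_sketch (R : realType) (d D p : nat) (hD : (0 < D)%N)
    (h : 'I_p -> {ffun 'I_d -> 'I_D}) (s : 'I_p -> {ffun 'I_d -> bool})
    (x : {ffun 'I_d -> R}) : {ffun 'I_D -> R} :=
  count_sketch (composite_hash hD h) (composite_sign R s) (tensor_power p x).

(* The events expressible in terms of the random element [f] of a discrete
   space [E]. *)
Definition events_of (T E : Type) (f : T -> E) : set (set T) :=
  [set f @^-1` B | B in [set: set E]].

(* Mutual independence of a finite collection of classes of events. *)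
Definition mutually_independent (disp : measure_display)
    (T : measurableType disp) (R : realType) (P : probability T R)
    (I : finType) (F : I -> set (set T)) : Prop :=
  forall (J : {set I}) (A : I -> set T),
    (forall i, i \in J -> F i (A i)) ->
    P (\bigcap_(i in [set` J]) A i) = (\prod_(i in J) P (A i))%E.

(* [f] is a random function U -> V sampled from a k-wise independent family;
   the family, together with its sampling rule, is the law of [f].  The vector
   (f i)_(i in I) is uniform on V^I: it takes each value with probability
   1 / |V|^|I|, where a point of V^I is given as the restriction to [I] of a
   function [g] on all of [U]. *)
Definition kwise_independent (disp : measure_display)
    (T : measurableType disp) (R : realType) (P : probability T R)
    (U V : finType) (k : nat) (f : T -> {ffun U -> V}) : Prop :=
  events_of f `<=` measurable /\
  forall (I : {set U}) (g : {ffun U -> V}), (#|I| <= k)%N ->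
    P [set w | forall i, i \in I -> f w i = g i] = (#|V|%:R ^- #|I|)%:E.

(* Main.v *)
(* Expanding the sketches, the estimator X is a sum over pairs (u, v) of
   x_u y_v S(u) S(v) [H(u) = H(v)].  Each of its first two moments is a finite
   sum in which the sign expectation factors over j = 1, ..., p.  In the first
   moment only the terms with u = v survive.  In the second moment the terms
   (u, v, u', v') survive whose four letters are equal in pairs in every
   coordinate.  Those with u = v and u' = v' add up to E[X]^2, and each of the
   others carries a collision probability of at most 1/D.  With absolute values
   the surviving sum is a p-th power of a sum Q over four letters; splitting by
   the three ways of pairing them gives Q <= A + 2B with A = <|x|,|y|>^2 and
   B = |x|^2 |y|^2, so Var X <= (Q^p - A^p) / D, and A <= B gives
   Q^p - A^p <= (3^p - 1) B^p. *)
Require Import Defs.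
From HB Require Import structures.
From mathcomp Require Import all_boot all_order all_algebra.
From mathcomp Require Import all_classical all_reals all_analysis.
From mathcomp Require Import ring lra.
Import Order.TTheory GRing.Theory Num.Theory.
Local Open Scope classical_set_scope.
Local Open Scope ring_scope.

(** * k-wise independent weights *)

Section FiniteWeights.
Context {R : realType}.

(** A finite stand-in for the law of a random function, so that all moments below are computed as
    weighted finite sums. *)
Definition kwise_weight {U V : finType} (k : nat) (mu : {ffun U -> V} -> R) : Prop :=
  (forall f, 0 <= mu f) /\
  forall (I : {set U}) (g : {ffun U -> V}), (#|I| <= k)%N ->
    \sum_(f : {ffun U -> V} | [forall i in I, f i == g i]) mu f = #|V|%:R ^- #|I|.

(** The marginal on the empty set of points is the total mass. The function argument rules out an
    empty function space, whose total would be 0. *)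
Lemma kwise_weight_total {U V : finType} {k : nat} {mu : {ffun U -> V} -> R} :
  kwise_weight k mu -> {ffun U -> V} -> \sum_f mu f = 1.
Proof.
move=> [_ kmu] g; have := kmu finset.set0 g.
rewrite cards0 expr0 invr1 => /(_ isT) <-.
by apply: eq_bigl => f; apply/esym/forall_inP => i; rewrite inE.
Qed.

(* Pair each pattern on [I] with its flip at [i]: both are equally likely and
   [phi] takes opposite values on them. *)
Lemma kwise_weight_odd {U : finType} {k : nat} {nu : {ffun U -> bool} -> R}
    (I : {set U}) (i : U) (phi : {ffun U -> bool} -> R) :
  let flip (g : {ffun U -> bool}) : {ffun U -> bool} :=
    [ffun l => (l == i) (+) g l] in
  kwise_weight k nu -> (#|I| <= k)%N -> i \in I ->
  (forall f g : {ffun U -> bool}, {in I, f =1 g} -> phi f = phi g) ->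
  (forall g, phi (flip g) = - phi g) ->
  \sum_f nu f * phi f = 0.
Proof.
move=> flip [_ knu] leIk iI phiI phiN.
(* [r] resets [f] to [false] outside [I]. Its fixed points are canonical representatives of the
   patterns on [I], and each of its fibres over them has mass [2 ^- #|I|]. *)
pose r (f : {ffun U -> bool}) : {ffun U -> bool} := [ffun l => (l \in I) && f l].
have flipK : involutive flip.
  by move=> g; apply/ffunP => l; rewrite !ffunE addbA addbb.
rewrite (partition_big r (fun g => r g == g)) /=; last first.
  by move=> f _; apply/eqP/ffunP => l; rewrite !ffunE andbA andbb.
under eq_bigr => g /eqP rg.
  rewrite (eq_bigr (fun f => nu f * phi g)); last first.
    move=> f /eqP <-; congr (_ * _); apply: phiI => l lI.
    by rewrite ffunE lI.
  rewrite -big_distrl /=.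
  have -> : \sum_(f | r f == g) nu f = #|{: bool}|%:R ^- #|I|.
    rewrite -(knu I g leIk); apply: eq_bigl => f; apply/eqP/forall_inP => [<- l lI|H].
      by rewrite ffunE lI.
    rewrite -rg; apply/ffunP => l; rewrite !ffunE.
    by case: (boolP (l \in I)) => //= lI; rewrite (eqP (H l lI)).
  over.
rewrite -big_distrr /=.
suff -> : \sum_(g | r g == g) phi g = 0 by rewrite mulr0.
set s := \sum_(_ | _) _.
have : s = - s.
  rewrite {1}/s -sumrN (reindex_inj (inv_inj flipK)) /=.
  apply: eq_big => [g|g _]; last exact: phiN.
  apply/eqP/eqP => /ffunP rg; apply/ffunP => l; move: (rg l); rewrite !ffunE.
    case: (eqVneq l i) => [->|] /=; first by rewrite iI.
    by [].
  case: (eqVneq l i) => [->|] /=; first by rewrite iI.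
  by [].
by lra.
Qed.

Definition paired {U : finType} (a b c e : U) : bool :=
  [|| (a == b) && (c == e), (a == c) && (b == e) | (a == e) && (b == c)].

(** Four letters that do not match up in pairs contain one occurring exactly once, found by
    comparing [a] with the other three. *)
Lemma unpaired_odd {U : finType} (a b c e : U) : ~~ paired a b c e ->
  exists2 i, i \in [:: a; b; c; e] &
    (a == i) (+) (b == i) (+) (c == i) (+) (e == i).
Proof.
rewrite /paired => H.
case: (eqVneq a b) H => [<-|nab].
  case: (eqVneq c e) => [_|nce] //= _.
  (* Here [a = b] and [c != e], so one of [c], [e] differs from [a] and occurs once. *)
  exists (if a == c then e else c); first by rewrite !inE; case: ifP; rewrite eqxx ?orbT.
  case: (eqVneq a c) => [ac|nac]; rewrite ?eqxx.
    by subst c; rewrite (negbTE nce).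
  by rewrite (negbTE nac) (eq_sym e) (negbTE nce).
case: (eqVneq a c) => [ac|nac].
  subst c; move=> /=; rewrite (eq_sym b a) (negbTE nab) andbF orbF => nbe.
  exists b; first by rewrite !inE eqxx orbT.
  by rewrite (negbTE nab) eqxx (eq_sym e) (negbTE nbe).
case: (eqVneq a e) => [ae|nae] /=.
  subst e => nbc; exists b; first by rewrite !inE eqxx orbT.
  by rewrite (negbTE nab) eqxx (eq_sym c) (negbTE nbc).
move=> _; exists a; first by rewrite !inE eqxx.
by rewrite eqxx !(eq_sym _ a) (negbTE nab) (negbTE nac) (negbTE nae).
Qed.

Lemma sign_valb (a b : bool) : sign_val R (a (+) b) = sign_val R a * sign_val R b.
Proof. exact: signr_addb. Qed.

Lemma sign_val2 (b : bool) : sign_val R b * sign_val R b = 1.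
Proof. by rewrite -sign_valb addbb. Qed.

(** If the letters are paired, the signs cancel to 1 for every [f]. Otherwise flipping the sign at a
    letter of odd multiplicity negates the product, so the mean vanishes. *)
Lemma kwise_weight_sign4 {U : finType} {nu : {ffun U -> bool} -> R} (a b c e : U) :
  kwise_weight 4 nu ->
  \sum_f nu f * (sign_val R (f a) * sign_val R (f b)
                 * sign_val R (f c) * sign_val R (f e)) = (paired a b c e)%:R.
Proof.
move=> knu; have [pr|/unpaired_odd [i iin iodd]] := boolP (paired a b c e).
  rewrite -[RHS](kwise_weight_total knu [ffun=> false]); apply: eq_bigr => f _.
  rewrite -[RHS]mulr1; congr (_ * _); rewrite -!sign_valb.
  have -> : f a (+) f b (+) f c (+) f e = false; last by [].
  by case/or3P: pr => /andP[/eqP-> /eqP->]; do 2 case: (f _).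
apply: (kwise_weight_odd [set:: [:: a; b; c; e]]%SET i _ knu).
- by rewrite cardsE; apply: leq_trans (card_size _) _.
- by rewrite inE.
- by move=> f g fg; rewrite !fg ?inE ?eqxx ?orbT.
move=> g; rewrite -!sign_valb !ffunE.
set s := g a (+) g b (+) g c (+) g e.
have -> : (a == i) (+) g a (+) ((b == i) (+) g b) (+) ((c == i) (+) g c)
   (+) ((e == i) (+) g e) = true (+) s.
  rewrite -iodd /s.
  by case: (a == i); case: (b == i); case: (c == i); case: (e == i);
    case: (g a); case: (g b); case: (g c); case: (g e).
by rewrite sign_valb /sign_val expr1 mulN1r.
Qed.

Lemma kwise_weight_sign2 {U : finType} {nu : {ffun U -> bool} -> R} (a b : U) :
  kwise_weight 4 nu ->
  \sum_f nu f * (sign_val R (f a) * sign_val R (f b)) = (a == b)%:R.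
Proof.
(* The two extra copies of [a] contribute the square of a sign, which is 1. *)
move=> knu; have := kwise_weight_sign4 a b a a knu.
have -> : paired a b a a = (a == b).
  by rewrite /paired eqxx andbT (eq_sym b a) orbb orbb.
move=> <-; apply: eq_bigr => f _.
by rewrite -[in RHS]mulrA sign_val2 mulr1.
Qed.

(** A value of [f a] leaves a single value of [f b] for which the collision can occur. This gives
    [D] pairs of values, each of weight [D ^- 2]. The shifts [m] and [n] will be the contributions
    of the other coordinates to the composite hash. *)
Lemma kwise_weight_shifted_collision {U : finType} {D : nat}
    {mu : {ffun U -> 'I_D} -> R} (hD : (0 < D)%N) (a b : U) (m n : nat) :
  kwise_weight 2 mu -> a != b ->
  \sum_f mu f * (m + f a == n + f b %[mod D])%N%:R <= D%:R^-1.
Proof.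
move=> [mu0 kmu] ab.
(* [t r] is the residue of [m + r - n]; the natural number [D.-1 * n] stands for [- n] modulo
   [D]. *)
pose t (r : 'I_D) : 'I_D := Ordinal (ltn_pmod (m + r + D.-1 * n)%N hD).
have tP (f : {ffun U -> 'I_D}) : (m + f a == n + f b %[mod D])%N -> f b = t (f a).
  move=> /eqP E; apply: val_inj => /=.
  rewrite -modnDml E modnDml -[LHS](modn_small (ltn_ord (f b))).
  have -> : (n + f b + D.-1 * n = n * D + f b)%N by rewrite addnAC -mulSn prednK // mulnC.
  by rewrite modnMDl.
apply: (@le_trans _ _ (\sum_(r : 'I_D) \sum_(f : {ffun U -> 'I_D} | (f a == r) && (f b == t r)) mu f)).
  rewrite [leLHS](partition_big (fun f : {ffun U -> 'I_D} => f a) xpredT) //=.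
  apply: ler_sum => r _; rewrite [leRHS]big_mkcondr /=.
  apply: ler_sum => f /eqP <-.
  have [/tP ->|_] := boolP (m + f a == n + f b %[mod D])%N.
    by rewrite eqxx mulr1.
  by rewrite mulr0; case: ifP.
have sum_pair (r r' : 'I_D) :
    \sum_(f : {ffun U -> 'I_D} | (f a == r) && (f b == r')) mu f = D%:R ^- 2.
  pose g : {ffun U -> 'I_D} := [ffun l => if l == a then r else r'].
  have := kmu [set a; b]%SET g; rewrite cards2 ab card_ord => <- //.
  apply: eq_bigl => f; apply/andP/forall_inP => [[/eqP fa /eqP fb] l|H].
    by rewrite !inE => /orP[] /eqP ->; rewrite ffunE ?eqxx ?fa // [b == a]eq_sym (negbTE ab) fb.
  have := H a; have := H b; rewrite !inE !eqxx orbT /= !ffunE eqxx [b == a]eq_sym (negbTE ab).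
  by move=> -> // ->.
under eq_bigr do rewrite sum_pair.
rewrite sumr_const card_ord -[leLHS]mulr_natr expr2 invfM -mulrA mulVf ?mulr1 //.
by rewrite pnatr_eq0 -lt0n.
Qed.

End FiniteWeights.

(** * Product weights and composite hashing *)

Section ProductWeights.
Context {R : realType} {I E : finType}.
Implicit Types (mu : I -> E -> R) (a : {ffun I -> E}).

Definition product_weight mu a : R := \prod_i mu i (a i).

Lemma product_weight_prod mu (phi : I -> E -> R) :
  \sum_a product_weight mu a * \prod_i phi i (a i) =
  \prod_i \sum_e mu i e * phi i e.
Proof.
by rewrite bigA_distr_bigA; apply: eq_bigr => a _; rewrite -big_split.
Qed.

Lemma product_weight_total mu :
  (forall i, \sum_e mu i e = 1) -> \sum_a product_weight mu a = 1.
Proof. by move=> mu1; rewrite -bigA_distr_bigA big1. Qed.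

(* Exchanging [a j] with an independent copy [e] preserves the joint weight. *)
Lemma product_weight_resample mu (j : I) (psi : {ffun I -> E} -> R) :
  \sum_e mu j e = 1 ->
  \sum_a product_weight mu a * psi a =
  \sum_a product_weight mu a *
    \sum_e mu j e * psi [ffun i => if i == j then e else a i].
Proof.
move=> muj1.
pose upd a e : {ffun I -> E} := [ffun i => if i == j then e else a i].
pose swap (w : {ffun I -> E} * E) := (upd w.1 w.2, w.1 j).
have swapK : involutive swap.
  case=> a e; congr pair; last by rewrite /= ffunE eqxx.
  by apply/ffunP => i; rewrite !ffunE /=; case: eqP => // ->.
transitivity (\sum_(w : {ffun I -> E} * E) product_weight mu w.1 * mu j w.2 * psi w.1).
  rewrite -(pair_bigA _ (fun a e => product_weight mu a * mu j e * psi a)) /=.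
  by apply: eq_bigr => a _; rewrite -big_distrl -big_distrr /= muj1 mulr1.
rewrite (reindex_inj (inv_inj swapK)) /=.
under [RHS]eq_bigr do rewrite big_distrr.
rewrite pair_bigA; apply: eq_bigr => -[a e] _ /=.
rewrite mulrA; congr (_ * _).
rewrite /product_weight (bigD1 j) //= [in RHS](bigD1 j) //= ffunE eqxx.
rewrite (eq_bigr (fun i => mu i (a i))); first by ring.
by move=> i /negbTE ij; rewrite ffunE ij.
Qed.

End ProductWeights.

(** Choose a coordinate [j] where [u] and [v] differ. With all other hashes fixed, a collision of
    the composite hash is a shifted collision of the [j]-th one alone, and averaging keeps the
    bound. *)
Lemma composite_hash_collision {R : realType} {d D p : nat} (hD : (0 < D)%N)
    {mu : 'I_p -> {ffun 'I_d -> 'I_D} -> R} (u v : {ffun 'I_p -> 'I_d}) :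
  (forall j, kwise_weight 2 (mu j)) -> u != v ->
  \sum_(a : {ffun 'I_p -> {ffun 'I_d -> 'I_D}}) product_weight mu a *
    (composite_hash hD a u == composite_hash hD a v)%:R <= D%:R^-1.
Proof.
move=> kmu uv.
have total j : \sum_f mu j f = 1.
  by apply: (kwise_weight_total (kmu j)); exact: [ffun=> Ordinal hD].
have [j uvj] : exists j, u j != v j.
  apply/existsP; apply: contraNT uv; rewrite negb_exists => /forallP uv.
  by apply/eqP/ffunP => j; apply/eqP; rewrite -[_ == _]negbK.
rewrite (product_weight_resample _ j) //.
rewrite -[leRHS]mul1r -[X in _ <= X * _](product_weight_total _ total) big_distrl /=.
apply: ler_sum => a _; apply: ler_wpM2l.
  by apply: prodr_ge0 => i _; case: (kmu i).
pose c (w : {ffun 'I_p -> 'I_d}) := (\sum_(i < p | i != j) a i (w i))%N.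
have := kwise_weight_shifted_collision hD (u j) (v j) (c u) (c v) (kmu j) uvj.
apply: le_trans.
rewrite le_eqVlt; apply/orP; left; apply/eqP; apply: eq_bigr => f _; congr (_ * (_ : bool)%:R).
have sumE (w : {ffun 'I_p -> 'I_d}) :
    (\sum_(i < p) [ffun i => if i == j then f else a i] i (w i) = c w + f (w j))%N.
  rewrite (bigD1 j) //= ffunE eqxx addnC; congr (_ + _)%N.
  by apply: eq_bigr => i /negbTE ij; rewrite ffunE ij.
by rewrite -val_eqE /= !sumE.
Qed.

(** * Expansions into sums over words *)

Lemma dotp_count_sketch {R : realType} {U : finType} {D : nat} (H : U -> 'I_D)
    (S : U -> R) (x y : {ffun U -> R}) :
  dotp (count_sketch H S x) (count_sketch H S y) =
  \sum_(z : U * U) x z.1 * y z.2 * (S z.1 * S z.2) * (H z.1 == H z.2)%:R.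
Proof.
rewrite /dotp -(pair_bigA _ (fun u v => x u * y v * (S u * S v) * (H u == H v)%:R)) /=.
(* For [u] in bucket [k], membership of [v] in the same bucket becomes the collision indicator. The
   buckets then partition all [u]. *)
transitivity (\sum_k \sum_(u | H u == k) \sum_v x u * y v * (S u * S v) * (H u == H v)%:R).
  apply: eq_bigr => k _; rewrite !ffunE big_distrl /=; apply: eq_bigr => u /eqP Hu.
  rewrite big_distrr big_mkcond /=; apply: eq_bigr => v _.
  rewrite Hu eq_sym; case: ifP => _; rewrite ?mulr0 // mulr1; ring.
by rewrite [RHS](partition_big H xpredT).
Qed.

Lemma tensor_power_dotp {R : realType} {d : nat} (p : nat) (x y : {ffun 'I_d -> R}) :
  dotp (tensor_power p x) (tensor_power p y) = dotp x y ^+ p.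
Proof.
rewrite /dotp -[X in _ ^+ X](card_ord p) -prodr_const bigA_distr_bigA.
by apply: eq_bigr => u _; rewrite !ffunE -big_split.
Qed.

(** Distributivity over four words at once. It produces both p-th powers whose difference bounds the
    variance. *)
Lemma sum4_prod {R : realType} {V : finType} {p : nat} (F : V -> V -> V -> V -> R) :
  let W := {ffun 'I_p -> V} in
  \sum_(z : (W * W) * (W * W))
     \prod_(j < p) F (z.1.1 j) (z.1.2 j) (z.2.1 j) (z.2.2 j) =
  (\sum_a \sum_b \sum_c \sum_e F a b c e) ^+ p.
Proof.
move=> W.
rewrite -(pair_bigA _ (fun z z' : W * W =>
  \prod_(j < p) F (z.1 j) (z.2 j) (z'.1 j) (z'.2 j))) /=.
rewrite -(pair_bigA _ (fun u v : W => \sum_(z' : W * W)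
  \prod_(j < p) F (u j) (v j) (z'.1 j) (z'.2 j))) /=.
rewrite -[X in _ ^+ X](card_ord p) -prodr_const bigA_distr_bigA; apply: eq_bigr => u _.
rewrite bigA_distr_bigA; apply: eq_bigr => v _.
rewrite -(pair_bigA _ (fun u' v' : W =>
  \prod_(j < p) F (u j) (v j) (u' j) (v' j))) /=.
rewrite bigA_distr_bigA; apply: eq_bigr => u' _.
by rewrite bigA_distr_bigA.
Qed.

(** After replacing [Q] by [A + 2 * B], induct on [p]: both sides obey the same recursion, with [A]
    on the left where the right has [B], and every factor is nonnegative and monotone. *)
Lemma sum_pow_sub_le {R : realFieldType} (p : nat) (Q A B : R) :
  0 <= A -> A <= B -> 0 <= Q -> Q <= A + 2 * B ->
  Q ^+ p - A ^+ p <= (3 ^+ p - 1) * B ^+ p.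
Proof.
move=> A0 AB Q0 QAB; have B0 := le_trans A0 AB.
apply: (@le_trans _ _ ((A + 2 * B) ^+ p - A ^+ p)).
  by rewrite lerD2r; apply: lerXn2r; rewrite ?nnegrE //; lra.
elim: p => [|p IH]; first by rewrite !expr0; lra.
have -> : (A + 2 * B) ^+ p.+1 - A ^+ p.+1 =
  (A + 2 * B) * ((A + 2 * B) ^+ p - A ^+ p) + 2 * B * A ^+ p by rewrite !exprS; ring.
have -> : (3 ^+ p.+1 - 1) * B ^+ p.+1 =
  (B + 2 * B) * ((3 ^+ p - 1) * B ^+ p) + 2 * B * B ^+ p by rewrite !exprS; ring.
apply: lerD; last by apply: ler_wpM2l; [lra|exact: lerXn2r].
apply: ler_pM => //; [lra| |lra].
by rewrite subr_ge0; apply: lerXn2r; rewrite ?nnegrE //; lra.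
Qed.

(** * Sums over paired quadruples of letters *)

Section QuadrupleSums.
Context {R : realType} {d : nat} (x y : {ffun 'I_d -> R}).

Let F (a b c e : 'I_d) := `|x a| * `|y b| * (`|x c| * `|y e|).

(** This is the square of the inner product of the entrywise absolute values of [x] and [y]. *)
Let A := \sum_a \sum_c `|x a| * `|y a| * (`|x c| * `|y c|).

Lemma sum_parallel_pairs :
  \sum_a \sum_b \sum_c \sum_e F a b c e * ((a == b) && (c == e))%:R = A.
Proof.
apply: eq_bigr => a _; rewrite (bigD1 a) //= [X in _ + X]big1 ?addr0; last first.
  move=> b ba; apply: big1 => c _; apply: big1 => e _.
  by rewrite eq_sym (negbTE ba) mulr0.
apply: eq_bigr => c _; rewrite (bigD1 c) //= big1 ?addr0.
  by rewrite !eqxx mulr1.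
by move=> e ec; rewrite eqxx eq_sym (negbTE ec) mulr0.
Qed.

Let sq (t : R) : t * t = `|t| * `|t|.
Proof. by rewrite -normrM ger0_norm // -expr2 sqr_ge0. Qed.

(** Cauchy-Schwarz for the absolute values: after doubling and symmetrising in [a] and [c], the
    termwise difference is the square of [|x a| |y c| - |x c| |y a|]. *)
Lemma sum_parallel_pairs_le : A <= dotp x x * dotp y y.
Proof.
rewrite -(ler_pM2l (ltr0n _ 2 : 0 < 2%:R :> R)).
have -> : 2 * (dotp x x * dotp y y) =
    \sum_a \sum_c (x a * x a * (y c * y c) + y a * y a * (x c * x c)).
  rewrite mulr_natl mulr2n [X in _ + X]mulrC /dotp !big_distrlr.
  by rewrite -big_split /=; apply: eq_bigr => a _; rewrite -big_split.
rewrite /A big_distrr; apply: ler_sum => a _ /=.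
rewrite big_distrr; apply: ler_sum => c _ /=.
rewrite (sq (x a)) (sq (y c)) (sq (x c)) (sq (y a)).
by have := sqr_ge0 (`|x a| * `|y c| - `|x c| * `|y a|); nra.
Qed.

Lemma sum_crossed_pairs :
  \sum_a \sum_b \sum_c \sum_e F a b c e * ((a == c) && (b == e))%:R =
  dotp x x * dotp y y.
Proof.
rewrite /dotp big_distrlr /=; apply: eq_bigr => a _; apply: eq_bigr => b _.
rewrite (bigD1 a) //= [X in _ + X]big1 ?addr0; last first.
  by move=> c ca; apply: big1 => e _; rewrite eq_sym (negbTE ca) mulr0.
rewrite (bigD1 b) //= big1 ?addr0.
  by rewrite !eqxx mulr1 /F (sq (x a)) (sq (y b)); ring.
by move=> e eb; rewrite eqxx [b == e]eq_sym (negbTE eb) mulr0.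
Qed.

Lemma sum_antiparallel_pairs :
  \sum_a \sum_b \sum_c \sum_e F a b c e * ((a == e) && (b == c))%:R = A.
Proof.
apply: eq_bigr => a _; apply: eq_bigr => b _.
rewrite (bigD1 b) //= [X in _ + X]big1 ?addr0; last first.
  by move=> c cb; apply: big1 => e _; rewrite [b == c]eq_sym (negbTE cb) andbF mulr0.
rewrite (bigD1 a) //= big1 ?addr0.
  by rewrite !eqxx mulr1 /F; ring.
by move=> e ea; rewrite eq_sym (negbTE ea) mulr0.
Qed.

(** The indicator [paired] is at most the sum of the indicators of the three pairings, with overlaps
    when all letters agree. These contribute [A], [dotp x x * dotp y y] and [A]; one [A] is then
    enlarged by Cauchy-Schwarz. *)
Lemma sum_paired_le :
  \sum_a \sum_b \sum_c \sum_e F a b c e * (paired a b c e)%:R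
  <= A + 2 * (dotp x x * dotp y y).
Proof.
apply: (@le_trans _ _ (A + dotp x x * dotp y y + A)); last first.
  by have := sum_parallel_pairs_le; lra.
rewrite -{1}sum_parallel_pairs -sum_crossed_pairs -sum_antiparallel_pairs -!big_split.
apply: ler_sum => a _ /=; rewrite -!big_split.
apply: ler_sum => b _ /=; rewrite -!big_split.
apply: ler_sum => c _ /=; rewrite -!big_split.
apply: ler_sum => e _ /=; rewrite -!mulrDr; apply: ler_wpM2l.
  by rewrite /F -!normrM.
by rewrite -!natrD ler_nat /paired; do 3 case: (_ && _).
Qed.

End QuadrupleSums.

(** * Moments of the sketch inner product *)

Lemma prod_natr_bool {R : realType} {I : finType} (b : I -> bool) :
  \prod_i (b i)%:R = [forall i, b i]%:R :> R.
Proof.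
have [/forallP bT|] := boolP [forall i, b i].
  by rewrite big1 // => i _; rewrite bT.
rewrite negb_forall => /existsP[i /negbTE bi].
by rewrite (bigD1 i) //= bi mul0r.
Qed.

Section SketchMoments.
Context {R : realType} {d D p : nat} (hD : (0 < D)%N) (x y : {ffun 'I_d -> R}).
Context {mu : 'I_p -> {ffun 'I_d -> 'I_D} -> R} {nu : 'I_p -> {ffun 'I_d -> bool} -> R}.
Hypothesis kmu : forall j, kwise_weight 2 (mu j).
Hypothesis knu : forall j, kwise_weight 4 (nu j).

Let W := {ffun 'I_p -> 'I_d}.
Let HF := {ffun 'I_p -> {ffun 'I_d -> 'I_D}}.
Let SF := {ffun 'I_p -> {ffun 'I_d -> bool}}.

Definition sketch_weight (w : HF * SF) : R :=
  product_weight mu w.1 * product_weight nu w.2.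

Definition sketch_dotp (w : HF * SF) : R :=
  dotp (tensor_sketch hD w.1 w.2 x) (tensor_sketch hD w.1 w.2 y).

Let col (a : HF) (z : W * W) : R :=
  (composite_hash hD a z.1 == composite_hash hD a z.2)%:R.
Let sg (b : SF) (z : W * W) : R :=
  composite_sign R b z.1 * composite_sign R b z.2.
Let t (z : W * W) : R := tensor_power p x z.1 * tensor_power p y z.2.

Let sketch_dotpE w : sketch_dotp w = \sum_z t z * sg w.2 z * col w.1 z.
Proof. exact: dotp_count_sketch. Qed.

Let hash_total : \sum_a product_weight mu a = 1.
Proof.
apply: product_weight_total => j.
by apply: (kwise_weight_total (kmu j)); exact: [ffun=> Ordinal hD].
Qed.

Let sign_total : \sum_b product_weight nu b = 1.
Proof.
apply: product_weight_total => j.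
by apply: (kwise_weight_total (knu j)); exact: [ffun=> false].
Qed.

Lemma sketch_weight_total : \sum_w sketch_weight w = 1.
Proof.
rewrite -[RHS]mulr1 -[X in _ = X * _]hash_total -[X in _ = _ * X]sign_total.
by rewrite big_distrlr pair_bigA.
Qed.

(** Independence of hashes and signs splits each term into a sign mean and a collision mean. [Z] is
    the pairs of words for the first moment and the quadruples for the second. *)
Let exchange {Z : finType} (q : Z -> R) (s : SF -> Z -> R) (c : HF -> Z -> R) :
  \sum_w sketch_weight w * \sum_z q z * s w.2 z * c w.1 z =
  \sum_z q z * (\sum_b product_weight nu b * s b z) *
    (\sum_a product_weight mu a * c a z).
Proof.
under eq_bigr do rewrite big_distrr.
rewrite exchange_big; apply: eq_bigr => z _ /=.
rewrite -[RHS]mulrA [X in _ = _ * X]mulrC big_distrlr /= pair_bigA big_distrr /=.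
by apply: eq_bigr => w _; rewrite /sketch_weight; ring.
Qed.

Let sign_moment2 (z : W * W) :
  \sum_b product_weight nu b * sg b z = (z.1 == z.2)%:R.
Proof.
under eq_bigr do rewrite /sg /composite_sign -big_split.
rewrite (product_weight_prod nu
  (fun j f => sign_val R (f (z.1 j)) * sign_val R (f (z.2 j)))).
under eq_bigr do rewrite kwise_weight_sign2 //.
rewrite prod_natr_bool; congr (_%:R); congr nat_of_bool.
apply/forallP/eqP => [zz|-> //]; by apply/ffunP => j; apply/eqP.
Qed.

Let sign_moment4 (z : (W * W) * (W * W)) :
  \sum_b product_weight nu b * (sg b z.1 * sg b z.2) =
  \prod_(j < p) (paired (z.1.1 j) (z.1.2 j) (z.2.1 j) (z.2.2 j))%:R.
Proof.
under [RHS]eq_bigr => j _ do rewrite -(kwise_weight_sign4 _ _ _ _ (knu j)).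
rewrite -(product_weight_prod nu
  (fun j f => sign_val R (f (z.1.1 j)) * sign_val R (f (z.1.2 j))
     * sign_val R (f (z.2.1 j)) * sign_val R (f (z.2.2 j)))).
by apply: eq_bigr => b _; rewrite !big_split /= -[X in _ = _ * X]mulrA.
Qed.

Let m := dotp (tensor_power p x) (tensor_power p y).

Lemma sketch_dotp_mean : \sum_w sketch_weight w * sketch_dotp w = m.
Proof.
under eq_bigr do rewrite sketch_dotpE.
rewrite (exchange t sg col); under eq_bigr do rewrite sign_moment2.
rewrite -(pair_bigA _ (fun u v => t (u, v) * (u == v)%:R *
  \sum_a product_weight mu a * col a (u, v))) /=.
apply: eq_bigr => u _; rewrite (bigD1 u) //= [X in _ + X]big1 ?addr0.
  rewrite eqxx mulr1 (eq_bigr (product_weight mu)) ?hash_total ?mulr1 // => a _.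
  by rewrite /col eqxx mulr1.
by move=> v vu; rewrite eq_sym (negbTE vu) mulr0 mul0r.
Qed.

Let tt (z : (W * W) * (W * W)) : R := t z.1 * t z.2.

(** Writing the squared mean over the same quadruples as the second moment lets the two be
    subtracted term by term. *)
Let sqr_mean :
  m ^+ 2 = \sum_z tt z * ((z.1.1 == z.1.2) && (z.2.1 == z.2.2))%:R.
Proof.
have -> : m = \sum_z t z * (z.1 == z.2)%:R.
  rewrite -(pair_bigA _ (fun u v => t (u, v) * (u == v)%:R)) /=.
  apply: eq_bigr => u _; rewrite (bigD1 u) //= eqxx mulr1 big1 ?addr0 //.
  by move=> v vu; rewrite eq_sym (negbTE vu) mulr0.
rewrite expr2 big_distrlr pair_bigA; apply: eq_bigr => z _ /=.
by rewrite -mulnb natrM /tt; ring.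
Qed.

Let norm_tt (z : (W * W) * (W * W)) : `|tt z| =
  \prod_(j < p) (`|x (z.1.1 j)| * `|y (z.1.2 j)| * (`|x (z.2.1 j)| * `|y (z.2.2 j)|)).
Proof. by rewrite /tt /t !normrM !ffunE !normr_prod -!big_split. Qed.

Lemma sketch_dotp_variance_le :
  \sum_w sketch_weight w * (sketch_dotp w - m) ^+ 2
  <= (3 ^+ p - 1) / D%:R * dotp x x ^+ p * dotp y y ^+ p.
Proof.
(* [C] is the probability that both pairs of words collide, [pr] the sign mean of a quadruple, and
   [de] the indicator of the terms making up the squared mean. *)
pose C z := \sum_a product_weight mu a * (col a z.1 * col a z.2).
pose pr (z : (W * W) * (W * W)) : R :=
  \prod_(j < p) (paired (z.1.1 j) (z.1.2 j) (z.2.1 j) (z.2.2 j))%:R.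
pose de (z : (W * W) * (W * W)) : R :=
  ((z.1.1 == z.1.2) && (z.2.1 == z.2.2))%:R.
have -> : \sum_w sketch_weight w * (sketch_dotp w - m) ^+ 2 =
    \sum_z tt z * (pr z * C z - de z).
  transitivity (\sum_w sketch_weight w * sketch_dotp w ^+ 2 - m ^+ 2).
    rewrite (eq_bigr (fun w => sketch_weight w * sketch_dotp w ^+ 2
       - 2 * m * (sketch_weight w * sketch_dotp w) + m ^+ 2 * sketch_weight w)).
      rewrite big_split sumrB /= -!big_distrr /= sketch_dotp_mean sketch_weight_total.
      by ring.
    by move=> w _; ring.
  rewrite sqr_mean.
  have -> : \sum_w sketch_weight w * sketch_dotp w ^+ 2 =
      \sum_z tt z * pr z * C z.
    under eq_bigr => w _.
      have -> : sketch_dotp w ^+ 2 =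
          \sum_z tt z * (sg w.2 z.1 * sg w.2 z.2) * (col w.1 z.1 * col w.1 z.2).
        rewrite sketch_dotpE expr2 big_distrlr pair_bigA /=.
        by apply: eq_bigr => z _; rewrite /tt; ring.
      over.
    rewrite (exchange tt (fun b z => sg b z.1 * sg b z.2)
       (fun a z => col a z.1 * col a z.2)).
    by apply: eq_bigr => z _; rewrite sign_moment4.
  by rewrite -sumrB; apply: eq_bigr => z _; rewrite /de; ring.
have D0 : 0 < D%:R :> R by rewrite ltr0n.
have pr0 z : 0 <= pr z by apply: prodr_ge0 => j _; exact: ler0n.
have M0 a : 0 <= product_weight mu a by apply: prodr_ge0 => j _; case: (kmu j).
have C_ge0 z : 0 <= C z.
  by apply: sumr_ge0 => a _; rewrite mulr_ge0 // mulr_ge0 ?ler0n.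
have col01 a z : 0 <= col a z <= 1 by rewrite ler0n lern1 leq_b1.
(* When [de] is 1, both [C] and [pr] are 1 and the term cancels. Otherwise [C] is at most
   [1 / D]. *)
apply: (@le_trans _ _ (\sum_z `|tt z| * (pr z - de z) / D%:R)).
  apply: ler_sum => z _; have [dz|ndz] := boolP ((z.1.1 == z.1.2) && (z.2.1 == z.2.2)).
    rewrite /de dz; case/andP: dz => /eqP e1 /eqP e2.
    have -> : C z = 1.
      rewrite -[RHS]hash_total; apply: eq_bigr => a _.
      by rewrite /col e1 e2 !eqxx !mulr1.
    have -> : pr z = 1.
      by apply: big1 => j _; rewrite e1 e2 /paired !eqxx.
    by rewrite mulr1 subrr !mulr0 mul0r.
  rewrite /de (negbTE ndz) !subr0 -mulrA.
  apply: le_trans (ler_norm _) _.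
  rewrite normrM; apply: ler_wpM2l => //.
  rewrite ger0_norm ?mulr_ge0 //; apply: ler_wpM2l => //.
  (* One of the two pairs consists of distinct words; bounding the other collision factor by 1
     leaves a single collision probability. *)
  move: ndz; rewrite negb_and => /orP[] ne.
    apply: le_trans (composite_hash_collision hD _ _ kmu ne).
    apply: ler_sum => a _; apply: ler_wpM2l => //.
    by rewrite -[leRHS]mulr1; apply: ler_wpM2l; [case/andP: (col01 a z.1)|case/andP: (col01 a z.2)].
  apply: le_trans (composite_hash_collision hD _ _ kmu ne).
  apply: ler_sum => a _; apply: ler_wpM2l => //.
  by rewrite -[leRHS]mul1r; apply: ler_wpM2r; [case/andP: (col01 a z.2)|case/andP: (col01 a z.1)].
rewrite -big_distrl /= [leRHS](_ : _ = (3 ^+ p - 1) * (dotp x x * dotp y y) ^+ p / D%:R); last first.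
  by rewrite exprMn; ring.
apply: ler_wpM2r; first by rewrite invr_ge0 ltW.
under eq_bigr do rewrite mulrBr.
rewrite sumrB.
have -> : \sum_z `|tt z| * pr z = (\sum_a \sum_b \sum_c \sum_e
   `|x a| * `|y b| * (`|x c| * `|y e|) * (paired a b c e)%:R) ^+ p.
  rewrite -sum4_prod; apply: eq_bigr => z _.
  by rewrite norm_tt -big_split.
(* Equality of words is checked letter by letter, so [de] factors over the coordinates and this sum
   is a p-th power as well. *)
have -> : \sum_z `|tt z| * de z = (\sum_a \sum_b \sum_c \sum_e
   `|x a| * `|y b| * (`|x c| * `|y e|) * ((a == b) && (c == e))%:R) ^+ p.
  rewrite -sum4_prod; apply: eq_bigr => z _.
  rewrite norm_tt [in RHS]big_split /= prod_natr_bool; congr (_ * (nat_of_bool _)%:R).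
  apply/andP/forallP => [[/eqP-> /eqP->] j|H]; first by rewrite !eqxx.
  by split; apply/eqP/ffunP => j; case/andP: (H j) => /eqP ? /eqP ?.
rewrite sum_parallel_pairs; apply: sum_pow_sub_le.
- by do 2 (apply: sumr_ge0 => ? _); rewrite -!normrM.
- exact: sum_parallel_pairs_le.
- by do 4 (apply: sumr_ge0 => ? _); rewrite -!normrM mulr_ge0.
- exact: sum_paired_le.
Qed.

End SketchMoments.

Arguments sketch_weight {R d D p} mu nu w.

(** * Laws of discrete random elements *)

(** The passage from integrals to finite sums: a function of a finite-valued [F] is a linear
    combination of the indicators of its fibres. *)
Lemma expectation_finite {R : realType} {disp : measure_display}
    {T : measurableType disp} (P : probability T R) {E : finType} {F : T -> E}
    (g : E -> R) (mF : forall e, measurable (F @^-1` [set e])) :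
  'E_P[fun w => g (F w)]%E = (\sum_e g e * fine (P (F @^-1` [set e])))%:E.
Proof.
rewrite unlock /=.
under eq_integral => w _.
  have -> : (g (F w))%:E = \sum_(e : E) ((g e)%:E * (\1_(F @^-1` [set e]) w)%:E)%E.
    rewrite sumEFin (bigD1 (F w)) //= big1 ?addr0; last first.
      move=> e ne; rewrite indicE memNset ?mulr0 //=.
      by move=> /esym/eqP; rewrite (negbTE ne).
    by rewrite indicE mem_set // mulr1.
  over.
rewrite integral_sum //; last first.
  by move=> e; apply: integrableZl => //; apply: integrable_indic.
rewrite -sumEFin; apply: eq_bigr => e _.
rewrite integralZl //; last exact: integrable_indic.
by rewrite integral_indic // setIT EFinM fineK // fin_num_measure.
Qed.

Definition law {R : realType} {disp : measure_display} {T : measurableType disp}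
  (P : probability T R) {E : Type} (f : T -> E) (e : E) : R :=
  fine (P (f @^-1` [set e])).

(** The probability of agreeing with [g] on [I] is the mean of an indicator depending only on [f w],
    hence a finite sum of the law. *)
Lemma kwise_independent_law {R : realType} {disp : measure_display}
    {T : measurableType disp} {P : probability T R} {U V : finType} {k : nat}
    {f : T -> {ffun U -> V}} :
  kwise_independent P k f -> kwise_weight k (law P f).
Proof.
move=> [mf kf]; have mpre e : measurable (f @^-1` [set e]) by apply: mf; exists [set e].
split=> [e|I g leIk]; first exact: fine_ge0.
apply: EFin_inj; rewrite -(kf I g leIk).
pose agree (e : {ffun U -> V}) : bool := [forall i in I, e i == g i].
transitivity 'E_P[fun w => (agree (f w))%:R : R]%E.
  rewrite (expectation_finite P (fun e => (agree e)%:R) mpre).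
  congr EFin; rewrite big_mkcond; apply: eq_bigr => e _.
  by rewrite /agree; case: ifP => _; rewrite ?mul1r ?mul0r.
have -> : (fun w => (agree (f w))%:R) =
    \1_[set w | forall i, i \in I -> f w i = g i] :> (T -> R).
  apply/funext => w; rewrite indicE; congr (_%:R); congr nat_of_bool.
  apply/forall_inP/idP => [fg|].
    by rewrite inE /= => i /fg /eqP.
  by rewrite inE /= => fg i /fg /eqP.
rewrite expectation_indic //; apply: mf.
by exists [set e | forall i, i \in I -> e i = g i].
Qed.

(** Packs all the random functions into one random element of a finite type, to which
    [expectation_finite] applies. *)
Definition joint {T : Type} {I J E F : finType} (f : I -> T -> E) (g : J -> T -> F)
    (w : T) : {ffun I -> E} * {ffun J -> F} :=
  ([ffun i => f i w], [ffun j => g j w]).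

Section JointLaw.
Context {R : realType} {disp : measure_display} {T : measurableType disp}.
Context {P : probability T R} {I J E F : finType}.
Context {f : I -> T -> E} {g : J -> T -> F}.

Hypothesis mf : forall i, events_of (f i) `<=` measurable.
Hypothesis mg : forall j, events_of (g j) `<=` measurable.

Let A (e : {ffun I -> E} * {ffun J -> F}) (k : I + J) : set T :=
  match k with
  | inl i => f i @^-1` [set e.1 i] | inr j => g j @^-1` [set e.2 j]
  end.

Let joint_preimage e : joint f g @^-1` [set e] = \bigcap_(k in [set` [set: I + J]%SET]) A e k.
Proof.
apply/seteqP; split=> [w /= <- [i|j] _ /=|w Aw /=]; rewrite ?ffunE //.
case: e Aw => a b Aw; congr pair; apply/ffunP => i; rewrite ffunE.
  by apply: (Aw (inl i)); rewrite /= inE.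
by apply: (Aw (inr i)); rewrite /= inE.
Qed.

Lemma measurable_joint_preimage e : measurable (joint f g @^-1` [set e]).
Proof.
rewrite joint_preimage; apply: fin_bigcap_measurable => [|[i|j] _ /=].
- exact: finite_finset.
- by apply: mf; eexists.
- by apply: mg; eexists.
Qed.

(** A fibre of [joint] is the intersection of one fibre per component, so mutual independence over
    the full index set factors its probability. *)
Lemma law_joint e :
  mutually_independent P (fun k : I + J =>
    match k with inl i => events_of (f i) | inr j => events_of (g j) end) ->
  law P (joint f g) e = (\prod_i law P (f i) (e.1 i)) * (\prod_j law P (g j) (e.2 j)).
Proof.
move=> /(_ [set: I + J]%SET (A e)) ind; apply: EFin_inj.
rewrite /law fineK ?fin_num_measure //; last exact: measurable_joint_preimage.
rewrite joint_preimage ind; last by case=> [i|j] _; eexists.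
rewrite big_sumType EFinM -!prodEFin; congr (_ * _)%E.
- by apply: eq_big => i; rewrite ?inE //= => _; rewrite fineK // fin_num_measure //; apply: mf; eexists.
- by apply: eq_big => i; rewrite ?inE //= => _; rewrite fineK // fin_num_measure //; apply: mg; eexists.
Qed.

End JointLaw.

(** * Transfer of the moments to the probability space *)

Theorem theorem9 (R : realType) (disp : measure_display)
    (T : measurableType disp) (P : probability T R)
    (d D p : nat) (hd : (0 < d)%N) (hD : (0 < D)%N) (hp : (0 < p)%N)
    (x y : {ffun 'I_d -> R})
    (h : 'I_p -> T -> {ffun 'I_d -> 'I_D})
    (s : 'I_p -> T -> {ffun 'I_d -> bool})
    (h_indep : forall j, kwise_independent P 2 (h j))
    (s_indep : forall j, kwise_independent P 4 (s j))
    (hs_indep : mutually_independent P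
       (fun i : 'I_p + 'I_p =>
          match i with inl j => events_of (h j) | inr j => events_of (s j) end)) :
  let sketch (z : {ffun 'I_d -> R}) (w : T) : {ffun 'I_D -> R} :=
    tensor_sketch hD (fun j => h j w) (fun j => s j w) z in
  let X (w : T) : R := dotp (sketch x w) (sketch y w) in
  [/\ 'E_P[X]%E = (dotp (tensor_power p x) (tensor_power p y))%:E,
      dotp (tensor_power p x) (tensor_power p y) = dotp x y ^+ p
    & ('V_P[X] <= ((3 ^+ p - 1) / D%:R
         * norm2 x ^+ (2 * p) * norm2 y ^+ (2 * p))%:E)%E].
Proof.
move=> sketch X.
have mh j : events_of (h j) `<=` measurable by case: (h_indep j).
have ms j : events_of (s j) `<=` measurable by case: (s_indep j).
have kh j := kwise_independent_law (h_indep j).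
have ks j := kwise_independent_law (s_indep j).
pose Y w := sketch_dotp hD x y (joint h s w).
have XY : X = Y.
  apply/funext => w; rewrite /X /Y /sketch_dotp /sketch /=.
  have -> : [ffun j => h j w] = (fun j => h j w) :> ('I_p -> _).
    by apply/funext => j; rewrite ffunE.
  have -> // : [ffun j => s j w] = (fun j => s j w) :> ('I_p -> _).
  by apply/funext => j; rewrite ffunE.
(* Both moments come from this formula: [phi] is the identity for the mean and the squared deviation
   for the variance. *)
have EY (phi : R -> R) : 'E_P[fun w => phi (X w)]%E =
    (\sum_w sketch_weight (fun j => law P (h j)) (fun j => law P (s j)) w
       * phi (sketch_dotp hD x y w))%:E.
  rewrite XY /Y (expectation_finite P (fun w => phi (sketch_dotp hD x y w))
    (measurable_joint_preimage mh ms)).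
  congr EFin; apply: eq_bigr => w _; rewrite mulrC; congr (_ * _).
  exact: law_joint.
have EX : 'E_P[X]%E = (dotp (tensor_power p x) (tensor_power p y))%:E.
  by rewrite -(sketch_dotp_mean hD x y kh ks); exact: (EY id).
split=> //; first exact: tensor_power_dotp.
rewrite /variance unlock EX /=.
have -> (m : R) : ((X \- cst m) * (X \- cst m))%R = (fun w => (X w - m) ^+ 2).
  by apply/funext => w; rewrite expr2.
rewrite (EY (fun r => (r - _) ^+ 2)) lee_fin /norm2 !exprM !sqr_sqrtr.
- exact: sketch_dotp_variance_le.
- by apply: sumr_ge0 => i _; rewrite -expr2 sqr_ge0.
- by apply: sumr_ge0 => i _; rewrite -expr2 sqr_ge0.
Qed.
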